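(* For all integers $n,k$ with $1\le k\le n-1$, $$I_{n,k}=I_{n,k-1}+C_k\sum_{i=0}^{n-k} I_{i,k-1}\,U_{n-k-i,k}\qquad\text{and}\qquad U_{n,k}=U_{n,k-1}+\sum_{i=0}^{n-k}U_{i,k-1}\,C_k\,U_{n-k-i,k}.$$
   Context: $C_m=\frac{1}{m+1}\binom{2m}{m}$ is the $m$-th Catalan number. Parking rules: $n$ spots $1,\dots,n$; cars $c_1,\dots,c_n$ arrive in order with preferences $a_j\in[n]$; $k$-Naples rule: $c_j$ parks at $a_j$ if empty, otherwise checks spots $a_j-1,\dots,a_j-k$ (those $\ge1$) in order and parks in the first empty one, otherwise drives forward from $a_j$ and parks in the first empty spot after $a_j$ (failing if none). A preference is a $k$-Naples parking function if all cars park; $0$-Naples parking functions are ordinary parking functions. $I_{n,k}$ is the number of ascending (weakly increasing) $k$-Naples parking functions of length $n$, and $U_{n,k}$ is the number of those whose first entry is $1$. Conventions: $I_{n,0}=C_n$ for $n\ge0$ (in particular the empty sequence counts once, so $I_{0,k}=1$), $U_{n,0}=C_n$ for $n\ge1$, and $U_{0,k}=0$ for all $k\ge0$. *)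

(* Defs.v *)
From mathcomp Require Import all_boot.

Set Implicit Arguments.
Unset Strict Implicit.
Unset Printing Implicit Defensive.

(* The division is exact. *)
Definition catalan (m : nat) : nat := 'C(2 * m, m) %/ m.+1.

(* Spots are the naturals 1, ..., n.  The spots a car with preference a examines,
   in the order it examines them: a, then a - 1, ..., a - k (those >= 1), then
   a + 1, ..., n.  The car parks in the first empty one, and fails to park if
   none of them is empty. *)
Definition naples_route (n k a : nat) : seq nat :=
  a :: [seq a - i | i <- iota 1 k & i < a] ++ iota a.+1 (n - a).

Definition naples_spot (n k : nat) (occ : seq nat) (a : nat) : option nat :=
  ohead [seq x <- naples_route n k a | x \notin occ].

(* occ lists the spots that are already occupied. *)
Fixpoint all_park (n k : nat) (occ s : seq nat) : bool :=
  if s is a :: s' then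
    if naples_spot n k occ a is Some x then all_park n k (x :: occ) s' else false
  else true.

(* Here j : 'I_n stands for the spot j + 1. *)
Definition prefs (n : nat) (t : n.-tuple 'I_n) : seq nat :=
  [seq (nat_of_ord j).+1 | j <- t].

Definition naples_parking (n k : nat) (t : n.-tuple 'I_n) : bool :=
  all_park n k [::] (prefs t).

Definition ascending (n : nat) (t : n.-tuple 'I_n) : bool :=
  sorted leq (prefs t).

Definition I_count (n k : nat) : nat :=
  #|[set t : n.-tuple 'I_n | ascending t && naples_parking k t]|.

(* The empty sequence has no first entry, so U_count 0 k = 0. *)
Definition U_count (n k : nat) : nat :=
  #|[set t : n.-tuple 'I_n |
      [&& ascending t, naples_parking k t & ohead (prefs t) == Some 1]]|.

Lemma I_count0 (k : nat) : I_count 0 k = 1.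
Proof.
rewrite /I_count (_ : [set t | _] = [set: 0.-tuple 'I_0]) ?cardsT ?card_tuple //.
by apply/setP=> t; rewrite !inE tuple0.
Qed.

Lemma U_count0 (k : nat) : U_count 0 k = 0.
Proof. by apply/eqP; rewrite cards_eq0; apply/eqP/setP=> t; rewrite !inE tuple0. Qed.

(* Main.v *)
(* Let S_j be the number of cars with preference at most j, and call S_j - j the
   level at j.  When cars arrive in ascending order, a run of r consecutive
   negative levels starting at spot l leaves l empty until a car with
   preference l + r arrives, so an ascending preference is k-Naples iff every
   maximal run of negative levels has length at most k.

   A run of length t can be chosen in catalan t ways and is followed by a
   preference starting with 1, while a preference starting with 1 splits at its
   first return to level 0.  For the generating functions this reads
     I_k = 1 + P_k U_k,   U_k = Y I_k,   P_k = \sum_(t <= k) catalan t X^t,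
   with Y independent of k.  Expanding either factor of I_(k-1) I_k with the
   first equation and cancelling P_(k-1) Y I_(k-1) I_k gives
     I_k = I_(k-1) + catalan k X^k I_(k-1) U_k,
   and multiplying by Y gives the identity for U_k. *)
Require Import Defs.
From mathcomp Require Import all_boot all_algebra.
From mathcomp Require Import zify.

Set Implicit Arguments.
Unset Strict Implicit.
Unset Printing Implicit Defensive.

(** * Convolution of sequences *)

Definition conv (f g : nat -> nat) (n : nat) : nat :=
  \sum_(i < n.+1) f i * g (n - i).

Lemma eq_conv f f' g g' : f =1 f' -> g =1 g' -> conv f g =1 conv f' g'.
Proof. by move=> ef eg n; apply: eq_bigr => i _; rewrite ef eg. Qed.

Lemma convC f g : conv f g =1 conv g f.
Proof.
move=> n; rewrite /conv (reindex_inj rev_ord_inj) /=.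
by apply: eq_bigr => i _; rewrite subSS mulnC subKn // -ltnS.
Qed.

Lemma conv_coef f g N n : n < N ->
  conv f g n = (((\poly_(i < N) f i : {poly nat}) * \poly_(i < N) g i)`_n)%R.
Proof.
move=> nN; rewrite coefM; apply: eq_bigr => i _.
by rewrite !coef_poly !(leq_ltn_trans _ nN) ?leq_subr // -ltnS.
Qed.

(** Values at [n] involve only indices up to [n], so associativity is inherited from polynomials
    truncated at degree [n]. *)
Lemma convA f g h : conv f (conv g h) =1 conv (conv f g) h.
Proof.
move=> n; pose P u : {poly nat} := (\poly_(i < n.+1) u i)%R.
transitivity ((P f * (P g * P h))`_n)%R; last rewrite GRing.mulrA; rewrite coefM.
  apply: eq_bigr => i _; rewrite coef_poly ltn_ord -conv_coef //.
  by rewrite ltnS leq_subr.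
apply: eq_bigr => i _; rewrite (@conv_coef f g n.+1) // [X in _ * X = _]coef_poly.
by rewrite ltnS leq_subr.
Qed.

Lemma convDl f g h : conv (fun n => f n + g n) h =1 (fun n => conv f h n + conv g h n).
Proof.
by move=> n; rewrite /conv -big_split; apply: eq_bigr => i _; rewrite mulnDl.
Qed.

Lemma conv1n f : conv (fun n => n == 0) f =1 f.
Proof.
by move=> n; rewrite /conv big_ord_recl /= mul1n subn0 big1 ?addn0.
Qed.

(** * Ballot and Catalan numbers *)

(* Continuations by t further levels, all negative, from level - d. *)
Fixpoint ballot (t d : nat) : nat :=
  if t is t'.+1 then \sum_(e < d.+1) ballot t' e.+1 else 1.

Lemma ballotSS t d : ballot t.+1 d.+1 = ballot t.+1 d + ballot t d.+2.
Proof. by rewrite /= big_ord_recr. Qed.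

(** The difference of binomials from the reflection principle, written additively to avoid truncated
    subtraction; the double induction matches [ballotSS] with Pascal's rule. *)
Lemma ballot_bin t d :
  ballot t.+1 d + 'C(2 * t.+1 + d, t) = 'C(2 * t.+1 + d, t.+1).
Proof.
elim: t d => [|t IHt] d.
  by rewrite bin0 bin1 /= sum1_card card_ord; lia.
elim: d => [|d IHd].
  have -> : ballot t.+2 0 = ballot t.+1 1 by rewrite /= big_ord1.
  have:= IHt 1; rewrite addn0 addn1.
  have -> : 2 * t.+2 = (2 * t.+1).+2 by lia.
  rewrite !(binS (2 * t.+1).+1).
  have -> : 'C((2 * t.+1).+1, t.+2) = 'C((2 * t.+1).+1, t.+1).
    by rewrite -bin_sub; [congr 'C(_, _); lia | lia].
  lia.
have -> : 2 * t.+2 + d.+1 = (2 * t.+2 + d).+1 by lia.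
have:= IHt d.+2; have -> : 2 * t.+1 + d.+2 = 2 * t.+2 + d by lia.
rewrite (ballotSS t.+1) !(binS (2 * t.+2 + d)); lia.
Qed.

Lemma ballot_catalan t : ballot t 0 = catalan t.
Proof.
case: t => [|t]; first by rewrite /catalan bin0.
have e := ballot_bin t 0; rewrite addn0 in e.
rewrite /catalan; apply/eqP; rewrite eq_sym -(eqn_pmul2r (ltn0Sn t.+1)).
have eb := mul_bin_left (2 * t.+1) t.
have {}eb : t.+1 * 'C(2 * t.+1, t.+1) = t.+2 * 'C(2 * t.+1, t).
  by rewrite eb; congr (_ * _); lia.
have ec : 'C(2 * t.+1, t.+1) = ballot t.+1 0 * t.+2 by nia.
by rewrite ec mulnK.
Qed.

(** * Recursion along the levels *)

(* Ways to distribute the preferences of the q remaining cars over the m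
   remaining spots, when the last r levels were negative; the current level is
   m - q. *)
Fixpoint completions (k m r q : nat) : nat :=
  if m is m'.+1 then
    \sum_(p < q.+1)
      if m' < p then (if r < k then completions k m' r.+1 p else 0)
      else completions k m' 0 p
  else q == 0.

Definition started (k n : nat) : nat :=
  if n is m.+1 then \sum_(p < m.+1) completions k m 0 p else 0.

(** Split by the number [t] of further negative levels. The spot ending the run must absorb the
    whole deficit, so what follows depends on [m - t] and not on the depth reached. For [t >= m] the
    term vanishes, as [started k 0 = 0]. *)
Lemma completions_below k m r d : r <= k ->
  completions k m r (m + d) =
    ((m == 0) && (d == 0)) + \sum_(t < (k - r).+1) ballot t d * started k (m - t).
Proof.
elim: m r d => [|m IHm] r d rk.
  by rewrite big1 ?addn0 // => t _; rewrite muln0.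
rewrite [LHS]/= -(big_mkord xpredT (fun p =>
  if m < p then if r < k then completions k m r.+1 p else 0 else completions k m 0 p)).
rewrite (@big_cat_nat _ _ _ m.+1) //=; last by lia.
rewrite add0n big_ord_recl mul1n subn0; congr (_ + _).
  by rewrite /started big_mkord; apply: eq_bigr => p _; rewrite ltnNge -ltnS ltn_ord.
rewrite -{1}[m.+1]add0n; have -> : (m.+1 + d).+1 = d.+1 + m.+1 by lia.
rewrite big_addn addnK big_mkord.
case: (ltnP r k) => [rk'|kr]; last first.
  rewrite big1; last by move=> p _ /=; case: ifP => //; lia.
  have -> : k - r = 0 by lia.
  by rewrite big_ord0.
rewrite (eq_bigr (fun p : 'I_d.+1 =>
  \sum_(t < k - r) ballot t p.+1 * started k (m - t))); last first.
  move=> p _; rewrite ifT; last by lia.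
  have -> : p + m.+1 = m + p.+1 by lia.
  by rewrite IHm // andbF add0n subnS prednK // subn_gt0.
rewrite exchange_big; apply: eq_bigr => t _ /=.
by rewrite big_distrl.
Qed.

(** * Decomposition at the first zero level *)

(* The ways counted by [completions] that reach level 0 only at the end;
   meaningful for q <= m. *)
Fixpoint first_hits (m q : nat) : nat :=
  if m is m'.+1 then if q == m then 0 else \sum_(p < q.+1) first_hits m' p
  else 1.

Lemma exchange_conv_tail (F : nat -> nat -> nat) (G : nat -> nat) m q :
  \sum_(p < q.+1) \sum_(i < p.+1) F (m - i) (p - i) * G i =
  \sum_(i < q.+1) (\sum_(p < (q - i).+1) F (m - i) p) * G i.
Proof.
elim: q => [|q IHq]; first by rewrite !big_ord1.
rewrite big_ord_recr IHq [RHS]big_ord_recr /= [X in _ + X]big_ord_recr /=.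
rewrite addnA -big_split /= subnn big_ord1; congr (_ + _).
by apply: eq_bigr => i _; rewrite subSn -1?ltnS // [in RHS]big_ord_recr mulnDl.
Qed.

(** The level starts nonnegative, falls by at most one per spot and ends at 0, so it visits 0 before
    any negative level; [i] spots and [i] cars are left at that first visit. Hence the first factor
    is free of [k]. *)
Lemma completions_first_hits k m q : q <= m ->
  completions k m 0 q =
    \sum_(i < q.+1) first_hits (m - i) (q - i) * completions k i 0 i.
Proof.
elim: m q => [|m IHm] q qm.
  by move: qm; rewrite leqn0 => /eqP ->; rewrite big_ord1.
have [->|qm'] := eqVneq q m.+1.
  rewrite [RHS]big_ord_recr (_ : nat_of_ord ord_max = m.+1) // subnn mul1n big1 // => i _ /=.
  have im := ltn_ord i; rewrite subSn; last by lia.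
  by rewrite /= eqxx.
rewrite [LHS]/= (eq_bigr (fun p : 'I_q.+1 =>
  \sum_(i < p.+1) first_hits (m - i) (p - i) * completions k i 0 i)); last first.
  by move=> p _; rewrite ifF ?IHm //; have := ltn_ord p; lia.
rewrite (exchange_conv_tail first_hits (fun i => completions k i 0 i)).
apply: eq_bigr => i _; congr (_ * _); have := ltn_ord i => ilt.
by rewrite subSn; [rewrite /= ifF //; lia|lia].
Qed.

(** This is [U_k = Y I_k]; having the same [Y] for all [k] is what permits the later
    cancellation. *)
Lemma started_conv k : started k =1
  conv (fun i => if i is x.+1 then \sum_(p < x.+1) first_hits x p else 0)
       (fun n => completions k n 0 n).
Proof.
move=> [|m]; rewrite convC; first by rewrite /conv big_ord1 muln0.
rewrite /conv big_ord_recr /= subnn muln0 addn0.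
rewrite (eq_bigr (fun p : 'I_m.+1 =>
  \sum_(i < p.+1) first_hits (m - i) (p - i) * completions k i 0 i)); last first.
  by move=> p _; rewrite completions_first_hits // -ltnS.
rewrite (exchange_conv_tail first_hits (fun i => completions k i 0 i)).
by apply: eq_bigr => i _; rewrite subSn -1?ltnS // mulnC.
Qed.

(** * The recurrences in [k] *)

Lemma sum_conv_trunc (f g : nat -> nat) K n : g 0 = 0 ->
  \sum_(t < K.+1) f t * g (n - t) = conv (fun t => if t <= K then f t else 0) g n.
Proof.
move=> g0; rewrite /conv.
(* Both ranges extend to [N]: beyond [n] truncated subtraction yields [g 0 = 0], and beyond [K] the
   coefficient is zero. *)
pose N := maxn K.+1 n.+1.
rewrite (big_ord_widen N (fun t => f t * g (n - t))) ?leq_maxl //.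
rewrite (big_ord_widen N (fun t => (if t <= K then f t else 0) * g (n - t))) ?leq_maxr //.
rewrite big_mkcond [RHS]big_mkcond /=; apply: eq_bigr => t _; rewrite !ltnS.
by case: leqP => _; case: leqP => // /ltnW /eqP ->; rewrite g0 muln0.
Qed.

Lemma completions_diag k : (fun n => completions k n 0 n) =1
  (fun n => (n == 0) + conv (fun t => if t <= k then catalan t else 0) (started k) n).
Proof.
move=> n; have := @completions_below k n 0 0 (leq0n k).
rewrite addn0 subn0 andbT -sum_conv_trunc // => ->.
by congr (_ + _); apply: eq_bigr => t _; rewrite ballot_catalan.
Qed.

Lemma conv_monomial c k f n : f 0 = 0 ->
  conv (fun t => if t == k then c else 0) f n = c * f (n - k).
Proof.
move=> f0; rewrite /conv.
have [kn|nk] := ltnP k n.+1; last first.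
  rewrite (eqP (ltnW nk)) f0 muln0 big1 // => i _; rewrite ifF //.
  by apply/eqP; have := ltn_ord i; lia.
rewrite (bigD1 (Ordinal kn)) //= eqxx big1 ?addn0 // => i ik.
by rewrite ifF //; apply/negbTE: ik.
Qed.

Lemma completions_rec k n : let I k n := completions k n 0 n in
  I k.+1 n =
  I k n + conv (fun t => if t == k.+1 then catalan k.+1 else 0) (conv (I k) (started k.+1)) n.
Proof.
move=> I; set M := (fun t => if t == k.+1 then _ else _).
pose P k t := if t <= k then catalan t else 0.
have PS : P k.+1 =1 (fun t => P k t + M t).
  by move=> t; rewrite /P /M leq_eqVlt ltnS; case: eqVneq => [->|_]; rewrite ?ltnn ?addn0.
pose T := conv (started k.+1) (I k).
(* [e1] expands the factor at [k.+1], [e2] the one at [k]; the common term [conv (P k) T]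
   cancels. *)
have e1 : conv (I k.+1) (I k) n = I k n + (conv (P k) T n + conv M T n).
  rewrite (eq_conv (completions_diag k.+1) (frefl _)) convDl conv1n; congr (_ + _).
  by rewrite -convA (eq_conv PS (frefl _)) convDl.
have e2 : conv (I k.+1) (I k) n = I k.+1 n + conv (P k) T n.
  rewrite convC (eq_conv (completions_diag k) (frefl _)) convDl conv1n; congr (_ + _).
  rewrite -convA; apply: eq_conv => // m.
  (* Moving [Y] to the other factor turns [U_k I_(k+1)] into [U_(k+1) I_k]. *)
  rewrite (eq_conv (started_conv k) (frefl _)) /T (eq_conv (started_conv k.+1) (frefl _)).
  by rewrite -!convA; apply: eq_conv => // x; rewrite convC.
have -> : conv M (conv (I k) (started k.+1)) n = conv M T n.
  by apply: eq_conv => // m; rewrite convC.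
by move: e1; rewrite e2; lia.
Qed.

Lemma started_rec k n : started k.+1 n = started k n +
  conv (fun t => if t == k.+1 then catalan k.+1 else 0) (conv (started k) (started k.+1)) n.
Proof.
rewrite (started_conv k.+1) (eq_conv (frefl _) (@completions_rec k)) convC convDl.
rewrite convC -started_conv; congr (_ + _).
rewrite -convA; apply: eq_conv => // m; rewrite convC convA.
by apply: eq_conv => // x; rewrite started_conv.
Qed.

(** * Where one car parks *)

Lemma ohead_filter_cat (T : eqType) (p : pred T) s1 x s2 :
  {in s1, forall y, ~~ p y} -> p x -> ohead [seq y <- s1 ++ x :: s2 | p y] = Some x.
Proof.
move=> s1p px; rewrite filter_cat /= px (_ : filter p s1 = [::]) //.
by apply/eqP; rewrite -(negbK (_ == _)) -has_filter; apply/hasPn.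
Qed.

Lemma iota_split i n x : i <= x < i + n ->
  iota i n = iota i (x - i) ++ x :: iota x.+1 (i + n - x.+1).
Proof.
move=> /andP[ix xn]; have -> : n = (x - i) + (i + n - x.+1).+1 by lia.
by rewrite iotaD subnKC //=; congr (_ ++ _ :: iota _ _); lia.
Qed.

Lemma naples_spot_backward n k occ a x : 0 < x <= a -> a <= x + k ->
  x \notin occ -> (forall y, x < y <= a -> y \in occ) ->
  naples_spot n k occ a = Some x.
Proof.
move=> /andP[x0 xa] axk xo yo; rewrite /naples_spot /naples_route.
have [ax|xa'] := eqVneq a x; first by rewrite /= ax xo.
rewrite (@iota_split 1 k (a - x)); last by lia.
have xk : a - x < a by lia.
rewrite filter_cat map_cat [filter _ (_ :: _)]/= xk map_cons subKn // -catA cat_cons -cat_cons.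
apply: (@ohead_filter_cat _ (fun y => y \notin occ)) => // y.
rewrite negbK in_cons => /orP[/eqP->|/mapP[i]]; first by apply: yo; lia.
by rewrite mem_filter mem_iota => /andP[ia ii] ->; apply: yo; lia.
Qed.

Lemma naples_spot_forward n k occ a x : 0 < a < x -> x <= n ->
  x \notin occ -> (forall y, 0 < y < x -> y \in occ) ->
  naples_spot n k occ a = Some x.
Proof.
move=> /andP[a0 ax] xn xo yo; rewrite /naples_spot /naples_route.
rewrite (@iota_split a.+1 (n - a) x); last by lia.
rewrite catA -cat_cons.
apply: (@ohead_filter_cat _ (fun y => y \notin occ)) => // y.
rewrite negbK in_cons mem_cat => /orP[/eqP->|/orP[/mapP[i]|]].
- by apply: yo; lia.
- by rewrite mem_filter mem_iota => /andP[ia ii] ->; apply: yo; lia.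
by rewrite mem_iota => ii; apply: yo; lia.
Qed.

Lemma naples_spot_Some n k occ a x : 0 < a <= n ->
  naples_spot n k occ a = Some x -> [/\ x \notin occ, 0 < x <= n & a <= x + k].
Proof.
move=> an; rewrite /naples_spot => e.
have : x \in [seq y <- naples_route n k a | y \notin occ].
  by case: (filter _ _) e => //= y t [->]; rewrite mem_head.
rewrite mem_filter in_cons mem_cat => /andP[xo xr]; split=> //.
  case/orP: xr => [/eqP->//|/orP[/mapP[i]|]]; last by rewrite mem_iota; lia.
  by rewrite mem_filter mem_iota; lia.
case/orP: xr => [/eqP->|/orP[/mapP[i]|]]; [lia| |by rewrite mem_iota; lia].
by rewrite mem_filter mem_iota; lia.
Qed.

Lemma all_park_cons n k occ a s x : naples_spot n k occ a = Some x ->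
  all_park n k occ (a :: s) = all_park n k (x :: occ) s.
Proof. by move=> /= ->. Qed.

(** * The street after a block of equal preferences *)

Definition spots_le a (occ : seq nat) := forall x, x \in occ -> 0 < x <= a.
Definition fills a (occ : seq nat) := forall x, 0 < x <= a -> x \in occ.

Lemma size_spots_le a occ : uniq occ -> spots_le a occ -> size occ <= a.
Proof.
move=> u le; rewrite -(size_iota 1 a); apply: uniq_leq_size => // x /le.
by rewrite mem_iota; lia.
Qed.

Lemma size_fills a occ : fills a occ -> a <= size occ.
Proof.
move=> f; rewrite -[a in a <= _](size_iota 1 a); apply: uniq_leq_size (iota_uniq _ _) _ => x.
by rewrite mem_iota => xa; apply: f; lia.
Qed.

Lemma fills_size a occ : uniq occ -> spots_le a occ -> a <= size occ -> fills a occ.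
Proof.
move=> u le sz x xa; have lei : {subset occ <= iota 1 a}.
  by move=> y /le; rewrite mem_iota; lia.
have [] := uniq_min_size u lei; first by rewrite size_iota.
by move=> _ ->; rewrite mem_iota; lia.
Qed.

(* A hole i + 1 is the last spot of i + 1, ..., a to be filled by cars that
   prefer a and back up. *)
Definition filling i a (occ : seq nat) :=
  [/\ uniq occ, spots_le a occ, fills i occ & i.+1 \in occ -> size occ = a].

Lemma filling_step n k i a occ : i < a <= i.+1 + k -> filling i a occ ->
  size occ < a -> exists2 x, naples_spot n k occ a = Some x & filling i a (x :: occ).
Proof.
move=> ia [u le fi hi] sz.
have ex : exists x, (0 < x <= a) && (x \notin occ).
  have: has (fun x => x \notin occ) (iota 1 a).
    rewrite -[has _ _]negbK -all_predC; apply/negP => /allP al.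
    suff /size_fills : fills a occ by lia.
    by move=> x xa; have := al x; rewrite /= negbK mem_iota; apply; lia.
  by case/hasP=> x; rewrite mem_iota => xi xo; exists x; rewrite xo andbT; lia.
have ub : forall x, (0 < x <= a) && (x \notin occ) -> x <= a by move=> x; lia.
(* The car takes the largest empty spot up to [a]; it exceeds [i], so [a <= i.+1 + k] puts it within
   reach. *)
case: (ex_maxnP ex ub) => x /andP[xa xo] xmax.
have ix : i < x by rewrite ltnNge; apply/negP => xi; move: xo; rewrite fi //; lia.
have above y : x < y <= a -> y \in occ.
  move=> xya; apply/negPn/negP => yo.
  by have := xmax y; rewrite yo andbT => /(_ _); lia.
exists x; first by apply: naples_spot_backward => //; lia.
have le' : spots_le a (x :: occ) by move=> y; rewrite in_cons => /orP[/eqP->//|/le].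
have u' : uniq (x :: occ) by rewrite /= xo.
split=> //; first by move=> y yi; rewrite in_cons fi ?orbT.
rewrite in_cons => /orP[/eqP e|/hi]; last by lia.
apply/eqP; rewrite eqn_leq size_spots_le //=; apply: (@size_fills a (x :: occ)) => y ya.
rewrite in_cons; case: (ltngtP y x) => //= [yx|xy]; first by apply: fi; lia.
by apply: above; lia.
Qed.

Lemma filling_block n k i a c occ : i < a <= i.+1 + k -> filling i a occ ->
  size occ + c <= a -> exists occ',
  [/\ forall s, all_park n k occ (nseq c a ++ s) = all_park n k occ' s,
      filling i a occ' & size occ' = size occ + c].
Proof.
move=> ia; elim: c occ => [|c IHc] occ fo sz; first by exists occ; rewrite addn0.
have [|x ex fx] := filling_step n ia fo; first by lia.
have [|occ' [ep f' s']] := IHc _ fx; first by rewrite /=; lia.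
exists occ'; split=> //; last by rewrite s' /=; lia.
by move=> s; rewrite -ep -(all_park_cons _ ex).
Qed.

Definition full (occ : seq nat) :=
  [/\ uniq occ, spots_le (size occ) occ & fills (size occ) occ].

Lemma full_block n k a c occ : full occ -> 0 < a <= size occ -> size occ + c <= n ->
  exists occ',
  [/\ forall s, all_park n k occ (nseq c a ++ s) = all_park n k occ' s,
      full occ' & size occ' = size occ + c].
Proof.
elim: c occ => [|c IHc] occ fo ao sz; first by exists occ; rewrite addn0.
have [u le fi] := fo.
have nx : (size occ).+1 \notin occ by apply/negP => /le; lia.
have ex : naples_spot n k occ a = Some (size occ).+1.
  by apply: naples_spot_forward => //; lia.
have [|||occ' [ep f' s']] := IHc ((size occ).+1 :: occ); rewrite /=; try by lia.
  split=> /= [|x|x]; first by rewrite nx.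
    by rewrite in_cons => /orP[/eqP->|/le]; lia.
  rewrite in_cons => xi; have [//|xn] := eqVneq x (size occ).+1.
  by apply: fi; lia.
exists occ'; split=> //; last by rewrite s' /=; lia.
by move=> s; rewrite -ep -(all_park_cons _ ex).
Qed.

(** With [i = j] the hole lies just past the occupied spots, which are then exactly [1, ..., j]:
    this encodes level 0. *)
Definition holed i j (occ : seq nat) :=
  [/\ uniq occ, spots_le j occ, fills i occ & i.+1 \notin occ].

(* The street once all cars with preferences at most j have parked, r being
   the number of levels below zero since the last nonnegative one. *)
Definition street r j (occ : seq nat) :=
  (r <= j /\ holed (j - r) j occ) \/ (full occ /\ j < size occ).

Lemma full_street j occ : full occ -> j <= size occ -> street 0 j occ.
Proof.
move=> fo; rewrite leq_eqVlt => /orP[/eqP e|jo]; last by right.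
left; split=> //; have [u le fi] := fo.
by rewrite subn0 e; split=> //; apply/negP => /le; lia.
Qed.

(** The leftmost hole of a negative run is filled last, so it survives exactly when the level at
    [j.+1] is negative; the run then has length [r.+1]. *)
Lemma street_block n k r j c occ : street r j occ -> r <= k -> size occ + c <= n ->
  exists occ',
  [/\ forall s, all_park n k occ (nseq c j.+1 ++ s) = all_park n k occ' s,
      size occ' = size occ + c &
      if size occ' <= j then r <= j /\ holed (j - r) j.+1 occ' else street 0 j.+1 occ'].
Proof.
move=> st rk sz; case: st => [[rj [u le fi hi]]|[fo jo]]; last first.
  have [|occ' [ep f' s']] := full_block k fo (_ : 0 < j.+1 <= _) sz; first by lia.
  exists occ'; split=> //; rewrite ifF; last by lia.
  by apply: full_street => //; lia.
have so : size occ <= j by apply: size_spots_le.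
have f0 : filling (j - r) j.+1 occ.
  by split=> // [x /le|/negPn]; [lia|rewrite hi].
have ia : j - r < j.+1 <= (j - r).+1 + k by lia.
(* These cars back up into the free spots up to [j.+1]; any others extend the full prefix. *)
pose c1 := minn c (j.+1 - size occ).
have [|occ1 [ep1 f1 s1]] := @filling_block n k (j - r) j.+1 c1 occ ia f0; first by lia.
have [u1 le1 fi1 hi1] := f1.
case: (leqP (size occ + c) j) => [cj|jc].
  have ec : c1 = c by lia.
  exists occ1; rewrite ec in ep1 s1; split=> //; rewrite s1 cj; split=> //.
  by split=> //; apply/negP => /hi1; lia.
have ff : full occ1.
  have e1 : size occ1 = j.+1 by lia.
  by split; rewrite ?e1 //; apply: (fills_size u1 le1); rewrite e1.
have [||occ' [ep f' s']] := @full_block n k j.+1 (c - c1) occ1 ff; try by lia.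
exists occ'; split; last by rewrite ifF; [apply: full_street => //; lia|lia].
  move=> s; rewrite -ep -ep1 catA -nseqD; congr (all_park _ _ _ (nseq _ _ ++ _)); lia.
lia.
Qed.

(** No preference beyond [h + k] leads to [h], and there are at least as many cars as spots, so
    leaving [h] empty makes some car fail. *)
Lemma all_park_unreachable n k h occ s : 0 < h <= n -> h \notin occ -> uniq occ ->
  spots_le n occ -> all (fun a => h + k < a <= n) s -> n <= size occ + size s ->
  all_park n k occ s = false.
Proof.
move=> hn; elim: s occ => [|a s IHs] occ ho u le /=.
  move=> _ sz; have:= @size_spots_le n (h :: occ).
  rewrite /= ho u => /(_ isT) le'.
  suff ltn : size occ < n by move: sz; rewrite addn0 leqNgt ltn.
  by apply: le' => x; rewrite in_cons => /orP[/eqP->|/le].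
case/andP=> ha al sz; case e: naples_spot => [x|] //.
have [|xo xn ax] := naples_spot_Some _ e; first by lia.
apply: IHs => //=.
- by rewrite in_cons negb_or ho andbT; apply/eqP; lia.
- by rewrite xo.
- by move=> y; rewrite in_cons => /orP[/eqP->|/le].
- by lia.
Qed.

(** * Ascending preferences, generated spot by spot *)

Fixpoint ascents (m j q : nat) : seq (seq nat) :=
  if m is m'.+1 then
    [seq nseq (q - p) j.+1 ++ s | p <- iota 0 q.+1, s <- ascents m' j.+1 p]
  else if q is 0 then [:: [::]] else [::].

Lemma ascentsS m j q : ascents m.+1 j q =
  [seq nseq (q - p) j.+1 ++ s | p <- iota 0 q.+1, s <- ascents m j.+1 p].
Proof. by []. Qed.

Lemma sorted_nseq_cat c x s : sorted leq s -> all (leq x) s ->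
  sorted leq (nseq c x ++ s).
Proof.
move=> so al; case: c => //= c.
by elim: c => [|c IHc] /=; [rewrite path_min_sorted|rewrite leqnn].
Qed.

Lemma sorted_nseq_filter x s : sorted leq s -> all (leq x) s ->
  s = nseq (count_mem x s) x ++ [seq y <- s | y != x].
Proof.
move=> so al; apply: (sorted_eq leq_trans anti_leq) => //.
  apply: sorted_nseq_cat; first exact: (sorted_filter leq_trans).
  by rewrite all_filter; apply: sub_all al => y /= ->; rewrite implybT.
have /all_pred1P e := filter_all (pred1 x) s.
rewrite -size_filter -e perm_sym.
by apply: permEl; apply: (perm_filterC (pred1 x)).
Qed.

Lemma mem_ascents m j q s : (s \in ascents m j q) =
  [&& sorted leq s, size s == q & all (fun a => j < a <= j + m) s].
Proof.
elim: m j q s => [|m IHm] j q s.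
  rewrite [ascents _ _ _]/=.
  have -> : all (fun a => j < a <= j + 0) s = nilp s.
    by case: s => //= a s; have -> : (j < a <= j + 0) = false by lia.
  by case: q s => [|q] [|a s]; rewrite ?inE //= !andbF.
apply/allpairsPdep/and3P => [[p [t [pq]]]|[so /eqP sz al]].
  rewrite IHm => /and3P[so /eqP sz al] ->; move: pq; rewrite mem_iota => pq.
  split; last 1 first.
  - rewrite all_cat all_nseq; apply/andP; split; first by apply/orP; right; lia.
    by apply: sub_all al => a; lia.
  - by apply: sorted_nseq_cat => //; apply: sub_all al => a; lia.
  - by rewrite size_cat size_nseq sz; apply/eqP; lia.
have al1 : all (leq j.+1) s by apply: sub_all al => a; lia.
have es := sorted_nseq_filter so al1.
set t := filter _ s in es.
have ss : size s = count_mem j.+1 s + size t.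
  by rewrite {1}es size_cat size_nseq.
exists (size t), t; split; last 1 first.
- by rewrite {1}es; congr (nseq _ _ ++ _); lia.
- by rewrite mem_iota; lia.
rewrite IHm eqxx (sorted_filter leq_trans) //= all_filter.
by apply: sub_all al => a /= aj; apply/implyP; lia.
Qed.

Lemma ascents_uniq m j q : uniq (ascents m j q).
Proof.
elim: m j q => [|m IHm] j q; first by case: q.
apply: allpairs_uniq_dep; [exact: iota_uniq|by move=> p _; apply: IHm|].
(* The multiplicity of the smallest admissible value [j.+1] recovers [p]. *)
have cnt p s : s \in ascents m j.+1 p -> count_mem j.+1 (nseq (q - p) j.+1 ++ s) = q - p.
  rewrite mem_ascents => /and3P[_ _ /allP al].
  rewrite count_cat count_nseq /= eqxx mul1n.
  suff /count_memPn -> : j.+1 \notin s by rewrite addn0.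
  by apply/negP => /al; lia.
move=> u1 u2 /allpairsPdep[p1 [s1 [+ m1 ->]]] /allpairsPdep[p2 [s2 [+ m2 ->]]] /= e.
rewrite !mem_iota => i1 i2; have:= cnt _ _ m1; rewrite e cnt // => e12.
have ep : p1 = p2 by lia.
by move: e; rewrite ep => /eqP; rewrite eqseq_cat // eqxx => /eqP ->.
Qed.

(** Both sides recurse on the number [p] of cars left after spot [j.+1], and the count depends on
    the occupied spots only through [r] and their number. *)
Lemma sum_all_park n k m r j q occ : street r j occ -> r <= k ->
  j + m = n -> size occ + q = n ->
  \sum_(s <- ascents m j q) all_park n k occ s = completions k m r q.
Proof.
elim: m r j q occ => [|m IHm] r j q occ st rk jm sz.
  by case: q sz => [|q] _; rewrite ?big_nil // big_seq1.
rewrite ascentsS big_allpairs_dep -[iota 0 q.+1]/(index_iota 0 q.+1).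
rewrite big_mkord; apply: eq_bigr => -[p /= pq] _.
have [|occ' [ep s' st']] := @street_block n k r j (q - p) occ st rk; first by lia.
rewrite (eq_bigr (fun s => nat_of_bool (all_park n k occ' s))); last by move=> s _; rewrite ep.
have -> : (m < p) = (size occ' <= j) by lia.
case: ifP st' => [so [rj hol]|so st']; last by apply: IHm => //; lia.
case: ltnP => [rk'|kr].
  by apply: IHm => //; [left; rewrite subSS|lia|lia].
(* Here [r = k], and all remaining preferences exceed [j.+1], so each lies more than [k] above the
   hole [(j - r).+1]. *)
have [u le fi hi] := hol.
rewrite big1_seq // => s /=; rewrite mem_ascents => /and3P[_ /eqP ss al].
rewrite (@all_park_unreachable n k (j - r).+1) //; first by lia.
- by move=> x /le; lia.
- by apply: sub_all al => a; lia.
- by rewrite ss s' -addnA subnK ?sz.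
Qed.

(** * From tuples to the two counts *)

Lemma prefs_inj n : injective (@prefs n).
Proof.
move=> t u e; apply/val_inj; apply: (@inj_map _ _ (fun j : 'I_n => j.+1)) e.
by move=> i j [] /val_inj.
Qed.

Lemma card_ascending n (P : pred (seq nat)) :
  #|[set t : n.-tuple 'I_n | ascending t && P (prefs t)]| =
  \sum_(s <- ascents n 0 n) P s.
Proof.
rewrite -big_mkcond sum1_count -size_filter cardE -(size_map (@prefs n)).
apply: perm_size; apply: uniq_perm.
- by rewrite (map_inj_uniq (@prefs_inj n)) enum_uniq.
- by rewrite filter_uniq // ascents_uniq.
move=> s; rewrite mem_filter mem_ascents add0n; apply/mapP/idP => [[t]|].
  rewrite mem_enum inE /ascending => /andP[ta Pt] ->; rewrite Pt ta size_map size_tuple eqxx /=.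
  by apply/allP => x /mapP[i _ ->]; rewrite ltnS leq0n ltn_ord.
case/and4P=> Ps so /eqP sz /allP al.
case: n sz al => [|n] sz al.
  have e : s = [::] by case: s sz {so Ps al}.
  subst s; exists [tuple] => //.
  by rewrite mem_enum inE /ascending /prefs Ps.
have szt : size [seq inord x.-1 : 'I_n.+1 | x <- s] == n.+1 by rewrite size_map sz.
have e : s = prefs (Tuple szt).
  rewrite /prefs /= -map_comp -[LHS]map_id; apply/eq_in_map => x xs /=.
  by rewrite inordK; have := al x xs; lia.
by exists (Tuple szt) => //; rewrite mem_enum inE /ascending -e so.
Qed.

Lemma street_nil : street 0 0 [::].
Proof. by left; split=> //; split=> // x; lia. Qed.

Lemma I_count_completions n k : I_count n k = completions k n 0 n.
Proof.
rewrite -(@sum_all_park n k n 0 0 n [::] street_nil) //.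
by rewrite /I_count (card_ascending _ (all_park n k [::])).
Qed.

Lemma U_count_started n k : U_count n k = started k n.
Proof.
case: n => [|n]; first exact: U_count0.
pose P s := all_park n.+1 k [::] s && (ohead s == Some 1).
rewrite /U_count (card_ascending _ P) ascentsS big_allpairs_dep.
rewrite -[iota 0 n.+2]/(index_iota 0 n.+2) big_mkord big_ord_recr /=.
(* In the last summand, [p = n.+1], no car prefers spot 1, so it contributes nothing. *)
rewrite [X in _ + X]big1_seq ?addn0 => [|s]; last first.
  rewrite mem_ascents subnn /= /P => /and3P[_ _].
  case: s => [|a s] //=.
  by case/andP=> a1 _; case: eqP => [[]|]; [lia|rewrite andbF].
apply: eq_bigr => -[p /= pn] _.
have [|occ' [ep s' st']] := @street_block n.+1 k 0 0 (n.+1 - p) [::] street_nil (leq0n k).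
  by rewrite /=; lia.
rewrite (eq_bigr (fun s => nat_of_bool (all_park n.+1 k occ' s))); last first.
  move=> s _; rewrite /P ep; case: (n.+1 - p) (subn_gt0 p n.+1) => [|c] /=; first by lia.
  by rewrite eqxx andbT.
rewrite /= in s'; rewrite ifF in st'; last by lia.
by apply: sum_all_park => //; lia.
Qed.

Theorem theorem5p2 (n k : nat) (hk : 1 <= k <= n - 1) :
  I_count n k =
    I_count n (k - 1)
    + catalan k * \sum_(0 <= i < (n - k).+1) I_count i (k - 1) * U_count (n - k - i) k
  /\
  U_count n k =
    U_count n (k - 1)
    + \sum_(0 <= i < (n - k).+1) U_count i (k - 1) * catalan k * U_count (n - k - i) k.
Proof.
case: k hk => [//|k] _; rewrite subn1 /= !I_count_completions !U_count_started.
(* The vanishing at 0 required by [conv_monomial], inherited from [U_0 = 0]. *)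
have conv0 f : conv f (started k.+1) 0 = 0 by rewrite /conv big_ord1 muln0.
rewrite completions_rec started_rec !conv_monomial //.
split; congr (_ + _); [congr (_ * _)|rewrite big_distrr /=];
  rewrite big_mkord; apply: eq_bigr => i _; rewrite ?I_count_completions !U_count_started //.
by rewrite mulnCA mulnA.
Qed.
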